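(* If $0<\theta\le1$, then for all $x>0$, $$\psi'(x)>\frac{\theta e^{\theta/x}} {x^2\bigl(e^{\theta/x}-1\bigr)} \quad\text{and}\quad \psi''(x)\le\frac{\theta e^{\theta/x} \bigl[\theta-2x\bigl(e^{\theta/x}-1\bigr)\bigr]} {x^4\bigl(e^{\theta/x}-1\bigr)^2}.$$ If $\theta\ge2$, both inequalities are reversed: for all $x>0$, $$\psi'(x)<\frac{\theta e^{\theta/x}} {x^2\bigl(e^{\theta/x}-1\bigr)} \quad\text{and}\quad \psi''(x)\ge\frac{\theta e^{\theta/x} \bigl[\theta-2x\bigl(e^{\theta/x}-1\bigr)\bigr]} {x^4\bigl(e^{\theta/x}-1\bigr)^2}.$$
   Context: $\Gamma$ is Euler's gamma function and $\psi(x)=\Gamma'(x)/\Gamma(x)$ is the psi (digamma) function; $\psi'$ and $\psi''$ are its first and second derivatives (the trigamma and tetragamma functions). *)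

(* Defs.v *)
From HB Require Import structures.
From mathcomp Require Import all_boot all_order all_algebra.
From mathcomp Require Import all_classical all_reals all_analysis.

Set Implicit Arguments.
Unset Strict Implicit.
Unset Printing Implicit Defensive.

Import Order.TTheory GRing.Theory Num.Theory.
Import numFieldNormedType.Exports.

Local Open Scope classical_set_scope.
Local Open Scope ring_scope.

(* Euler's integral represents the gamma function for [0 < x] only; the values
   of [Gamma] and [psi] at [x <= 0] carry no mathematical meaning. *)
Definition Gamma {R : realType} (x : R) : R :=
  \int[@lebesgue_measure R]_(t in `]0, +oo[) (t `^ (x - 1) * expR (- t)).

Definition psi {R : realType} (x : R) : R := (Gamma^`())%classic x / Gamma x.

(* Main.v *)
Require Import Defs.
From HB Require Import structures.
From mathcomp Require Import all_boot all_order all_algebra.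
From mathcomp Require Import all_classical all_reals all_analysis.
From mathcomp Require Import ring lra measurable_realfun.
Import Order.TTheory GRing.Theory Num.Theory.
Import numFieldNormedType.Exports.
Local Open Scope classical_set_scope.
Local Open Scope ring_scope.

(** The two bounds are [G] and its derivative, where
[G x = (1/x) * todd (theta/x)] and [todd v = v / (1 - e^-v)]; indeed [G] is the
derivative of [x |-> - ln (e^(theta/x) - 1)], so the theorem says that
[psi x + ln (e^(theta/x) - 1)] is increasing and concave for [theta <= 1], and
decreasing and convex for [theta >= 2].

The proof puts an elementary function of [x] between each side.  Write
[u = 1/x], [v = theta/x] and [m v = d/dv (v * todd v)]
([deriv_v_todd]), so that [G' x = - u^2 * m v].

On the gamma side, [psi' x] is the sum of [(x + k)^-2] and [psi'' x] the sum of
[- 2 (x + k)^-3] over [k >= 0].  A sum over shifts [sum a (x + k)] is compared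
with [T x] by comparing [a y] with [T y - T (y + 1)], which is a rational
inequality ([lim_sum_shift_le], [lim_sum_shift_ge]).  This yields
  - [u^2 + 6x / (6x^2 + 3x + 1) <= psi' x < u + u^2],
  - [u^2 + 2u^3 >= - psi'' x >= 2u^3], and
  - [- psi'' x >= u^2 (1 + u/2)^2] for [x >= 1/2].

On the exponential side, with [w = e^v - 1],
  - [1 + v/2 <= todd v < v + 6 / (6 + 3v + v^2)],
  - [1 + v <= m v <= (1 + v/2)^2], and
  - [m v <= 2v] for [v >= 2].

The upper bound on [m] by a square is an equality up to a perfect square:
[(1 + v/2)^2 - m v = (1 - v/2 - v/w)^2].  Since [v <= u] for [theta <= 1] and
[v >= 2u] for [theta >= 2], the two lists combine to the four inequalities.

The series are reached from Euler's integral without differentiating under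
the integral sign, along the lines of the Bohr-Mollerup theorem.  Integration
by parts gives [Gamma (x + 1) = x * Gamma x], convexity of the exponential
gives log-convexity, and together they force Gauss's limit
[ln Gamma x = lim (ln Gamma n + x ln n - sum_(k < n) ln (x + k))]
([gauss_lnGamma_cvg]).  The functions on the right have second-order Taylor
remainders bounded uniformly in [n]; under that hypothesis a pointwise limit is
differentiable, and its derivative is the limit of the derivatives
([is_derive_lim]).  Three applications give [psi], [psi'] and [psi'']. *)

(** * Euler's integral and the functional equation *)

Section EulerIntegral.
Context {R : realType}.
Local Notation mu := (@lebesgue_measure R).
Implicit Types (x t a b : R) (n : nat).

Definition gamma_integrand x t : R := t `^ (x - 1) * expR (- t).

(** The extended-real value lets the functional equation be proved before the
convergence of the integral, which then follows from it. *)
Definition gamma_integral x : \bar R :=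
  (\int[mu]_(t in `]0%R, +oo[) (gamma_integrand x t)%:E)%E.

Lemma gamma_integrand_ge0 x t : 0 <= gamma_integrand x t.
Proof. by rewrite mulr_ge0 ?powR_ge0 ?expR_ge0. Qed.

Lemma measurable_gamma_integrand (D : set R) x :
  measurable_fun D (gamma_integrand x).
Proof.
apply: measurable_funTS; apply: measurable_funM.
  exact: measurable_powR.
by apply: measurableT_comp => //; exact: measurable_funTS.
Qed.

Lemma gamma_integral_ge0 x : (0 <= gamma_integral x)%E.
Proof. by apply: integral_ge0 => t _; rewrite lee_fin gamma_integrand_ge0. Qed.

(** The boundary term of the integration by parts at infinity: one term of the
exponential series, of degree above [x], dominates [t `^ x]. *)
Lemma powR_mul_expRN_cvg0 x :
  (n.+1%:R : R) `^ x * expR (- n.+1%:R) @[n --> \oo] --> (0 : R).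
Proof.
have [N xN] : exists N : nat, x <= N%:R.
  exists (Num.truncn `|x|).+1.
  by apply: (le_trans (ler_norm _)); apply/ltW; rewrite truncnS_gt.
apply: (@squeeze_cvgr _ _ _ _ (fun=> 0) (fun n => N.+1`!%:R * (n.+1%:R)^-1)).
- near=> n; rewrite mulr_ge0 ?powR_ge0 ?expR_ge0//=.
  have n0 : (0 : R) < n.+1%:R by [].
  apply: (@le_trans _ _ (n.+1%:R ^+ N * expR (- n.+1%:R))).
    rewrite ler_pM2r ?expR_gt0// -powR_mulrn//.
    by apply: ler_powR => //; rewrite ler1n.
  rewrite expRN ler_pdivrMr ?expR_gt0//.
  have := @expR_ge1Dxn R n.+1%:R N (ltW n0).
  move=> h.
  have {}h : n.+1%:R ^+ N.+1 / N.+1`!%:R <= expR n.+1%:R :> R.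
    by apply: le_trans h; rewrite lerDr.
  rewrite -ler_pdivrMl ?mulr_gt0 ?invr_gt0 ?ltr0n ?fact_gt0//.
  rewrite invfM invrK; apply: le_trans h.
  by rewrite exprS [leRHS]mulrC mulrA.
- exact: cvg_cst.
- rewrite -(mulr0 N.+1`!%:R); apply: cvgMr; exact: cvg_harmonic.
Unshelve. all: by end_near. Qed.

Lemma powR_mul_expRN_at0 x : 0 < x ->
  ((n.+2%:R)^-1 : R) `^ x * expR (- (n.+2%:R)^-1) @[n --> \oo] --> (0 : R).
Proof.
move=> x0.
have h : ((n.+2%:R)^-1 : R) @[n --> \oo] --> (0 : R).
  have := @cvg_harmonic R; rewrite -cvg_shiftS; exact.
rewrite -[0 in X in _ --> X](mul0r (expR (- 0))); apply: cvgM.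
  have /cvg_at_rightP := powR_cvg0 x0; apply; split => //.
apply: (cvg_comp _ (fun t : R => expR (- t)) h).
apply: continuous_comp; last exact: continuous_expR.
by apply: cvgN; exact: cvg_id.
Qed.
Lemma gamma_integral_by_parts x a b : 0 < x -> 0 < a -> a < b ->
  (\int[mu]_(t in `[a, b]) (gamma_integrand (x + 1) t)%:E =
   (a `^ x * expR (- a) - b `^ x * expR (- b))%:E +
   x%:E * \int[mu]_(t in `[a, b]) (gamma_integrand x t)%:E)%E.
Proof.
move=> x0 a0 ab.
have pos t : t \in `[a, b] -> 0 < t.
  by rewrite in_itv/= => /andP[+ _]; exact: lt_le_trans.
have dpow p t : 0 < t -> derivable (fun t : R => t `^ p) t 1.
  by move=> t0; apply: derivable_powR; rewrite in_itv/= t0.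
have cpow p t : 0 < t -> {for t, continuous (fun t : R => t `^ p)}.
  by move=> t0; apply/differentiable_continuous/derivable1_diffP/dpow.
have dexp t : is_derive t 1 (fun t : R => - expR (- t)) (expR (- t)).
  by apply: trigger_derive; rewrite /= mulrN1 opprK.
have cexp : continuous (fun t : R => expR (- t)).
  move=> t; apply: continuous_comp; last exact: continuous_expR.
  by apply: cvgN; exact: cvg_id.
have := @integration_by_parts R (fun t => t `^ x) (fun t => - expR (- t))
  (fun t => x * t `^ (x - 1)) (fun t => expR (- t)) a b ab.
have -> : (fun t : R => (t `^ x * expR (- t))%:E) =
          (fun t => (gamma_integrand (x + 1) t)%:E).
  by apply/funext => t; rewrite /gamma_integrand addrK.
move=> ->.
- have -> : (fun t : R => (x * t `^ (x - 1) * - expR (- t))%:E) =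
            (fun t => (- (x%:E * (gamma_integrand x t)%:E))%E).
    by apply/funext => t; rewrite /gamma_integrand -EFinM -EFinN mulrN mulrA.
  rewrite integral_ge0N; last first.
    by move=> t _; rewrite lee_fin mulr_ge0 ?(ltW x0)// gamma_integrand_ge0.
  rewrite oppeK ge0_integralZl_EFin//.
  + by congr (_%:E + _)%E; rewrite !mulrN opprK addrC.
  + by move=> t _; rewrite lee_fin gamma_integrand_ge0.
  + by apply/measurable_EFinP; exact: measurable_gamma_integrand.
  + exact: ltW.
- apply: continuous_in_subspaceT => t /set_mem/pos t0.
  by apply: cvgM; [exact: cvg_cst | exact: cpow].
- split.
  + by move=> t; rewrite in_itv/= => /andP[at_ _]; apply: dpow; apply: lt_trans at_.
  + by apply: cvg_at_right_filter; exact: cpow.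
  + by apply: cvg_at_left_filter; apply: cpow; exact: lt_trans ab.
- move=> t; rewrite in_itv/= => /andP[at_ _].
  by rewrite powR_derive1// in_itv/= (lt_trans a0 at_).
- exact: continuous_subspaceT.
- split.
  + by move=> t _; exact: ex_derive.
  + by apply: cvg_at_right_filter; apply: cvgN; exact: cexp.
  + by apply: cvg_at_left_filter; apply: cvgN; exact: cexp.
- by move=> t _; rewrite derive1E derive_val.
Qed.

(** Monotone convergence along segments that avoid the endpoint [0], where the
integrand is singular for [x < 1]. *)
Lemma gamma_integral_cvg x :
  (\int[mu]_(t in `[((n.+2%:R)^-1)%R : R, (n.+1%:R)%R]%classic) (gamma_integrand x t)%:E
    @[n --> \oo] --> gamma_integral x)%E.
Proof.
have -> : gamma_integral x =
    (\int[mu]_(t in \bigcup_n `[((n.+2%:R)^-1)%R : R, (n.+1%:R)%R]%classic)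
       (gamma_integrand x t)%:E)%E.
  rewrite /gamma_integral; congr (integral _ _ _).
  apply/seteqP; split => t /=; rewrite in_itv/= ?andbT => t0.
    exists (maxn (Num.truncn t) (Num.truncn t^-1)) => //=.
    rewrite in_itv/=; apply/andP; split.
      rewrite -[leRHS]invrK lef_pV2 ?posrE ?invr_gt0//; apply/ltW.
      apply: (lt_le_trans (truncnS_gt _)).
      by rewrite ler_nat ltnW// !ltnS leq_maxr.
    apply/ltW/(lt_le_trans (truncnS_gt _)).
    by rewrite ler_nat ltnS leq_maxl.
  case: t0 => n _ /=; rewrite in_itv/= => /andP[+ _].
  by apply: lt_le_trans; rewrite invr_gt0.
apply: ge0_nondecreasing_set_cvg_integral => //.
- apply/nondecreasing_seqP => n; rewrite subsetEset => t /=.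
  rewrite !in_itv/= => /andP[nt tn]; apply/andP; split.
    by apply: le_trans nt; rewrite lef_pV2 ?posrE// ler_nat.
  by apply: (le_trans tn); rewrite ler_nat.
- by move=> n; apply/measurable_EFinP; exact: measurable_gamma_integrand.
- by move=> n t _; rewrite lee_fin gamma_integrand_ge0.
Qed.

Lemma gamma_integralD1 x : 0 < x ->
  (gamma_integral (x + 1) = x%:E * gamma_integral x)%E.
Proof.
move=> x0.
rewrite -(cvg_lim (@ereal_hausdorff R) (gamma_integral_cvg (x + 1))).
apply: (cvg_lim (@ereal_hausdorff R)).
rewrite -[X in _ --> X]add0e.
have lt_seg n : (n.+2%:R)^-1 < n.+1%:R :> R.
  rewrite (@lt_le_trans _ _ 1) ?ler1n//.
  by rewrite invf_lt1// ltr1n.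
rewrite (_ : (fun n => _) = (fun n => (((n.+2%:R)^-1 `^ x * expR (- (n.+2%:R)^-1) -
    n.+1%:R `^ x * expR (- n.+1%:R)))%:E + x%:E *
  \int[mu]_(t in `[((n.+2%:R)^-1)%R : R, (n.+1%:R)%R]%classic) (gamma_integrand x t)%:E)%E).
  apply: cvgeD.
  - by rewrite fin_num_adde_defr.
  - apply: cvg_EFin; first exact: nearW.
    rewrite -[X in _ --> X](subrr 0); apply: cvgB.
      exact: powR_mul_expRN_at0.
    exact: powR_mul_expRN_cvg0.
  - by apply: cvgeZl => //; exact: gamma_integral_cvg.
by apply/funext => n; rewrite gamma_integral_by_parts// invr_gt0.
Qed.

Lemma gamma_integral_le_natr x n : 1 <= x -> x <= n%:R + 1 ->
  (gamma_integral x <= gamma_integral 1 + gamma_integral (n%:R + 1))%E.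
Proof.
move=> x1 xn; rewrite -ge0_integralD//=; last 4 first.
- by move=> t _; rewrite lee_fin gamma_integrand_ge0.
- by apply/measurable_EFinP; exact: measurable_gamma_integrand.
- by move=> t _; rewrite lee_fin gamma_integrand_ge0.
- by apply/measurable_EFinP; exact: measurable_gamma_integrand.
apply: ge0_le_integral => //=.
- by move=> t _; rewrite lee_fin gamma_integrand_ge0.
- by apply/measurable_EFinP; exact: measurable_gamma_integrand.
- by apply: emeasurable_funD; apply/measurable_EFinP; exact: measurable_gamma_integrand.
move=> t; rewrite in_itv/= andbT => t0; rewrite -EFinD lee_fin /gamma_integrand.
rewrite -mulrDl ler_pM2r ?expR_gt0// subrr powRr0 addrK.
have [t1|/ltW t1] := leP t 1.
  apply: (@le_trans _ _ 1); last by rewrite lerDl powR_ge0.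
  rewrite -[leRHS](powRr0 t); apply: ger_powR; first by rewrite t0.
  by rewrite subr_ge0.
apply: (@le_trans _ _ (t `^ n%:R)); last by rewrite lerDr.
by apply: ler_powR => //; rewrite lerBlDr.
Qed.

Lemma gamma_integral1_lty : (gamma_integral 1 < +oo)%E.
Proof.
rewrite /gamma_integral.
have -> : (fun t => (gamma_integrand 1 t)%:E) = (fun t : R => (expR (- t))%:E).
  by apply/funext => t; rewrite /gamma_integrand subrr powRr0 mul1r.
have cexp : continuous (fun t : R => expR (- t)).
  move=> t; apply: continuous_comp; last exact: continuous_expR.
  by apply: cvgN; exact: cvg_id.
have dexp t : is_derive t 1 (fun t : R => - expR (- t)) (expR (- t)).
  by apply: trigger_derive; rewrite /= mulrN1 opprK.
rewrite integral_itv_obnd_cbnd; last first.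
  by apply/measurable_EFinP; apply: measurable_funTS; exact: continuous_measurable_fun.
rewrite (@ge0_continuous_FTC2y _ _ (fun t => - expR (- t)) _ (- 0)).
- by rewrite -EFinB ltry.
- by move=> t _; exact: expR_ge0.
- exact: continuous_subspaceT.
- by apply: cvgN; exact: cvgr_expR.
- by move=> t _; exact: ex_derive.
- by apply: cvg_at_right_filter; apply: cvgN; exact: cexp.
- by move=> t _; rewrite derive1E derive_val.
Qed.

(** The functional equation carries finiteness from [1] to all integers; these
dominate every [x >= 1], and the equation read backwards covers [0 < x < 1]. *)
Lemma gamma_integral_lty x : 0 < x -> (gamma_integral x < +oo)%E.
Proof.
have nat_lty n : (gamma_integral (n%:R + 1) < +oo)%E.
  elim: n => [|n ih]; first by rewrite add0r; exact: gamma_integral1_lty.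
  rewrite -natr1 gamma_integralD1; last by rewrite ltr_wpDl.
  by rewrite lte_mul_pinfty// lee_fin addr_ge0.
have ge1_lty y : 1 <= y -> (gamma_integral y < +oo)%E.
  move=> y1; apply: (le_lt_trans (@gamma_integral_le_natr y (Num.truncn y) y1 _)).
    by apply/ltW; rewrite natr1 truncnS_gt.
  by rewrite lte_add_pinfty// gamma_integral1_lty.
move=> x0; have := @ge1_lty (x + 1); rewrite lerDr => /(_ (ltW x0)).
rewrite gamma_integralD1//.
(* an infinite value at [x] would make the product with [x > 0] infinite *)
move: (gamma_integral_ge0 x); case: (gamma_integral x) => [r _ _|_|//].
  exact: ltry.
by rewrite gt0_muley// lte_fin.
Qed.

Lemma integrable_gamma_integrand x : 0 < x ->
  mu.-integrable `]0, +oo[ (EFin \o gamma_integrand x).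
Proof.
move=> x0; apply/integrableP; split.
  by apply/measurable_EFinP; exact: measurable_gamma_integrand.
under eq_integral => t _ do rewrite gee0_abs ?lee_fin ?gamma_integrand_ge0//.
exact: gamma_integral_lty.
Qed.

Lemma GammaE x : 0 < x -> (Gamma x)%:E = gamma_integral x.
Proof.
move=> x0; rewrite /Gamma /Rintegral -/(gamma_integral x) fineK//.
by rewrite ge0_fin_numE ?gamma_integral_ge0// gamma_integral_lty.
Qed.

Lemma GammaD1 x : 0 < x -> Gamma (x + 1) = x * Gamma x.
Proof.
move=> x0; apply: EFin_inj.
by rewrite GammaE ?addr_gt0// gamma_integralD1// EFinM GammaE.
Qed.

Lemma Gamma_gt0 x : 0 < x -> 0 < Gamma x.
Proof.
move=> x0; rewrite -lte_fin GammaE//.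
apply: (@lt_le_trans _ _ (\int[mu]_(t in `[1%R, 2%R]) (expR (- 2) / 2)%:E)%E).
  rewrite integral_cst//= lebesgue_measure_itv/= lte_fin ltr1n -EFinD -EFinM.
  by rewrite lte_fin mulr_gt0 ?divr_gt0 ?expR_gt0// subr_gt0 ltr1n.
apply: (@le_trans _ _ (\int[mu]_(t in `[1%R, 2%R]) (gamma_integrand x t)%:E)%E).
  apply: ge0_le_integral => //=.
    by apply/measurable_EFinP; exact: measurable_gamma_integrand.
  move=> t; rewrite in_itv/= => /andP[t1 t2]; rewrite lee_fin mulrC.
  apply: ler_pM; rewrite ?invr_ge0 ?expR_ge0//; last by rewrite ler_expR lerN2.
  apply: (@le_trans _ _ t^-1).
    by rewrite lef_pV2 ?posrE// (lt_le_trans _ t1).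
  rewrite -powR_inv1 ?(le_trans _ t1)//; apply: ler_powR => //.
  by rewrite lerBrDr addrC subrr ltW.
apply: ge0_subset_integral => //=.
- by apply/measurable_EFinP; exact: measurable_gamma_integrand.
- by move=> t _; rewrite lee_fin gamma_integrand_ge0.
- by move=> t /=; rewrite !in_itv/= andbT => /andP[+ _]; exact: lt_le_trans.
Qed.
End EulerIntegral.

(** * Derivatives of pointwise limits *)

Section UniformTaylor.
Context {R : realType}.

(** The difference quotients of [F n] at step [h] are within [C * `|h|] of
[d n], uniformly in [n], and converge as [n] grows; hence [d] is a Cauchy
sequence, and the Taylor bound passes to the limit.  The convergence of [d] is
thus part of the conclusion. *)
Lemma is_derive_lim (F : nat -> R -> R) (f : R -> R) (d : nat -> R)
    (x r C : R) : 0 < r ->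
  (forall y, `|y - x| < r -> F n y @[n --> \oo] --> f y) ->
  (forall n h, `|h| < r -> `|F n (x + h) - F n x - h * d n| <= C * h ^+ 2) ->
  exists l, d n @[n --> \oo] --> l /\ is_derive x 1 f l.
Proof.
move=> r0 Ff FC.
have C0 : 0 <= C.
  have := FC 0 (r / 2); rewrite ger0_norm; last by rewrite ltW// divr_gt0.
  rewrite ltr_pdivrMr// ltr_pMr// ltr1n => /(_ isT) h.
  have := le_trans (normr_ge0 _) h.
  by rewrite pmulr_lge0// exprn_gt0// divr_gt0.
have Fx : F n x @[n --> \oo] --> f x by apply: Ff; rewrite subrr normr0.
have Fxh h : `|h| < r -> F n (x + h) @[n --> \oo] --> f (x + h).
  by move=> hr; apply: Ff; rewrite addrC addKr.
have /cauchy_cvgP/cvg_ex[l dl] : cauchy (d @ \oo).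
  apply: cauchy_exP => e e0 /=.
  pose h := Num.min (r / 2) (e / (2 * (C + 1))).
  have C1 : 0 < C + 1 by rewrite ltr_wpDl.
  have h0 : 0 < h.
    by rewrite lt_min !divr_gt0// mulr_gt0.
  have hr : `|h| < r.
    rewrite gtr0_norm// gt_min ltr_pdivrMr// ltr_pMr// ltr1n.
    by [].
  have he : C * h < e / 2.
    apply: (@lt_le_trans _ _ ((C + 1) * h)); first by rewrite ltr_pM2r// ltrDl.
    apply: (@le_trans _ _ ((C + 1) * (e / (2 * (C + 1))))).
      by rewrite ler_pM2l// ge_min lexx orbT.
    by rewrite le_eqVlt; apply/orP; left; apply/eqP; field; rewrite gt_eqF.
  exists ((f (x + h) - f x) / h).
  have : (F n (x + h) - F n x) / h @[n --> \oo] --> (f (x + h) - f x) / h.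
    by apply: cvgMl; apply: cvgB => //; exact: Fxh.
  move=> /cvgrPdist_lt/(_ (e / 2)) => /(_ (divr_gt0 e0 (ltr0Sn _ _))).
  apply: filterS => n /= cn.
  rewrite /ball/= (splitr e).
  apply: le_lt_trans (ler_distD ((F n (x + h) - F n x) / h) _ _) _.
  apply: ltrD => //; apply: le_lt_trans he.
  rewrite -(ler_pM2r h0) -[X in _ * X <= _](gtr0_norm h0) -normrM mulrBl mulfVK ?gt_eqF//.
  by rewrite [d n * h]mulrC -mulrA -expr2; exact: FC.
exists l; split => //.
have fl h : `|h| < r -> `|f (x + h) - f x - h * l| <= C * h ^+ 2.
  move=> hr.
  have cv : `|F n (x + h) - F n x - h * d n| @[n --> \oo] -->
      `|f (x + h) - f x - h * l|.
    apply: cvg_norm; apply: cvgB; last exact: cvgMr.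
    by apply: cvgB => //; exact: Fxh.
  rewrite -(cvg_lim (@Rhausdorff R) cv); apply: limr_le; first by apply/cvg_ex; eexists; exact: cv.
  by apply: nearW => n; exact: FC.
have dq : h^-1 *: (f (h *: (1 : R) + x) - f x) @[h --> 0^'] --> l.
  apply/cvgrPdist_le => e e0; near=> h.
  have h0 : h != 0 by near: h; exact: nbhs_dnbhs_neq.
  have hr : `|h| < r.
    near: h; apply: dnbhs0_lt => //.
  have he : `|h| < e / (C + 1).
    by near: h; apply: dnbhs0_lt; rewrite divr_gt0// ltr_wpDl.
  rewrite -(ler_pM2r (_ : 0 < `|h|)) ?normr_gt0// -normrM mulrBl.
  rewrite /GRing.scale/= mulr1 mulrAC mulVf// mul1r distrC [h + x]addrC [l * h]mulrC.
  apply: (le_trans (fl _ hr)).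
  rewrite -real_normK ?num_real// expr2 mulrA ler_pM2r ?normr_gt0//.
  apply: (@le_trans _ _ ((C + 1) * `|h|)).
    by rewrite ler_wpM2r// lerDl.
  by rewrite mulrC -ler_pdivlMr ?ltr_wpDl// ltW.
split; first by apply/cvg_ex; exists l.
exact: cvg_lim dq.
Unshelve. all: by end_near. Qed.
End UniformTaylor.

(** * Log-convexity and Gauss's limit *)

Section LogGamma.
Context {R : realType}.
Local Notation mu := (@lebesgue_measure R).
Implicit Types (x t a b l : R) (n m : nat).

Definition lnGamma x : R := ln (Gamma x).

Lemma expR_lnGamma x : 0 < x -> expR (lnGamma x) = Gamma x.
Proof. by move=> x0; rewrite lnK// posrE Gamma_gt0. Qed.

Lemma lnGammaD1 x : 0 < x -> lnGamma (x + 1) = lnGamma x + ln x.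
Proof.
by move=> x0; rewrite /lnGamma GammaD1// lnM ?posrE ?Gamma_gt0// addrC.
Qed.

(** Average the tangent line of [expR] at the mean of [a] and [b]. *)
Lemma expR_convex l a b : 0 <= l <= 1 ->
  expR (l * a + (1 - l) * b) <= l * expR a + (1 - l) * expR b.
Proof.
move=> /andP[l0 l1]; set m := l * a + (1 - l) * b.
have tangent y : expR m * (1 + (y - m)) <= expR y.
  have -> : expR y = expR m * expR (y - m) by rewrite -expRD subrKC.
  by rewrite ler_pM2l ?expR_gt0// expR_ge1Dx.
have -> : expR m = l * (expR m * (1 + (a - m))) + (1 - l) * (expR m * (1 + (b - m))).
  by rewrite /m; ring.
by apply: lerD; rewrite ler_wpM2l ?tangent// subr_ge0.
Qed.

Lemma gamma_integrandE x t : 0 < t ->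
  gamma_integrand x t = expR ((x - 1) * ln t - t).
Proof. by move=> t0; rewrite /gamma_integrand /powR gt_eqF// -expRD. Qed.

(** This is Hoelder's inequality for the gamma integrals: divide the integrands
at [a] and [b] by [Gamma a] and [Gamma b] so that both have integral 1, apply
convexity of [expR] to their logarithms pointwise, and integrate. *)
Lemma lnGamma_convex l a b : 0 < a -> 0 < b -> 0 <= l <= 1 ->
  lnGamma (l * a + (1 - l) * b) <= l * lnGamma a + (1 - l) * lnGamma b.
Proof.
move=> a0 b0 /[dup] l01 /andP[l0 l1]; set c := l * a + (1 - l) * b.
have c0 : 0 < c.
  have [l_eq0|l_neq0] := eqVneq l 0.
    by rewrite /c l_eq0 mul0r add0r subr0 mul1r.
  have lgt0 : 0 < l by rewrite lt_def l_neq0.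
  by rewrite ltr_pwDl ?mulr_gt0// mulr_ge0 ?subr_ge0// ltW.
set K := expR (l * lnGamma a + (1 - l) * lnGamma b).
have K0 : 0 < K by exact: expR_gt0.
suff : Gamma c <= K.
  by move=> GcK; rewrite -ler_expR expR_lnGamma.
have Za k x : 0 < x -> mu.-integrable `]0, +oo[ (EFin \o (fun t => k * gamma_integrand x t)).
  move=> x0; rewrite (_ : _ \o _ = (fun t => k%:E * (EFin \o gamma_integrand x) t)%E)//.
  by apply: integrableZl => //; exact: integrable_gamma_integrand.
have -> : K = \int[mu]_(t in `]0, +oo[) (K * l / Gamma a * gamma_integrand a t +
                                   K * (1 - l) / Gamma b * gamma_integrand b t).
  rewrite RintegralD//; [|exact: Za|exact: Za].
  rewrite !RintegralZl ?integrable_gamma_integrand// -/(Gamma a) -/(Gamma b).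
  move: (Gamma_gt0 _ a0) (Gamma_gt0 _ b0) => {Za}; move: (Gamma a) (Gamma b) K {K0} => u v K u0 v0.
  by field; rewrite !gt_eqF.
rewrite -[Gamma c]/(\int[mu]_(t in `]0, +oo[) gamma_integrand c t).
apply: le_Rintegral => //.
- exact: integrable_gamma_integrand.
- rewrite (_ : _ \o _ = ((EFin \o (fun t => (K * l / Gamma a * gamma_integrand a t)%R)) \+
    (EFin \o (fun t => (K * (1 - l) / Gamma b * gamma_integrand b t)%R)))%E)//.
  by apply: integrableD => //; exact: Za.
move=> t /=; rewrite in_itv/= andbT => t0; rewrite !gamma_integrandE//.
have -> : expR ((c - 1) * ln t - t) =
    K * expR (l * ((a - 1) * ln t - t - lnGamma a) +
              (1 - l) * ((b - 1) * ln t - t - lnGamma b)).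
  rewrite /K -expRD; congr expR; rewrite /c.
  by move: (lnGamma a) (lnGamma b) => *; ring.
rewrite -!(mulrA K) -mulrDr ler_pM2l//.
move: (expR_lnGamma _ a0) (expR_lnGamma _ b0).
move: (lnGamma a) (lnGamma b) => ga gb <- <-.
apply: (le_trans (expR_convex _ _ _ l01)).
rewrite (expRB _ ga) (expRB _ gb) !mulrA.
by rewrite ![_ * expR _ * _]mulrAC.
Qed.

Lemma lnGammaDn x n : 0 < x ->
  lnGamma (x + n%:R) = lnGamma x + \sum_(k < n) ln (x + k%:R).
Proof.
move=> x0; elim: n => [|n ih]; first by rewrite big_ord0 !addr0.
by rewrite big_ord_recr/= -natr1 addrA lnGammaD1 ?ltr_wpDr// ih addrA.
Qed.

(** Logarithm of Gauss's product for the gamma function, with [Gamma n] in the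
place of [n.-1`!]. *)
Definition gauss_lnGamma n x : R :=
  lnGamma n%:R + x * ln n%:R - \sum_(k < n) ln (x + k%:R).

Lemma ln_addr_le a b : 0 < a -> 0 <= b -> ln (a + b) <= ln a + b / a.
Proof.
move=> a0 b0; have ba0 : 0 <= b / a by rewrite divr_ge0// ltW.
have -> : a + b = a * (1 + b / a) by field; rewrite gt_eqF.
rewrite lnM ?posrE ?ltr_wpDr// lerD2l.
by apply: le_ln1Dx; apply: lt_le_trans ba0; rewrite ltrN10.
Qed.

(** Convexity between [n], [n + x] and [n + m] bounds the increment of [lnGamma]
over [[n, n + x]] by the slope over [[n, n + m]], which the functional equation
expresses by logarithms. *)
Lemma gauss_lnGamma_ge n m x : 0 < x -> x <= m%:R ->
  lnGamma x - x * m%:R / n.+2%:R <= gauss_lnGamma n.+2 x.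
Proof.
move=> x0 xm; rewrite /gauss_lnGamma.
have m0 : 0 < m%:R :> R by exact: lt_le_trans xm.
have n0 : (0 : R) < n.+2%:R by [].
have := @lnGamma_convex (x / m%:R) (n.+2%:R + m%:R) n.+2%:R.
rewrite divr_ge0 ?(ltW x0) ?(ltW m0)//= ler_pdivrMr// mul1r addr_gt0//.
move=> /(_ isT n0 xm).
have -> : x / m%:R * (n.+2%:R + m%:R) + (1 - x / m%:R) * n.+2%:R = x + n.+2%:R.
  by field; rewrite gt_eqF.
rewrite lnGammaDn// lnGammaDn//.
set S := \sum_(k < n.+2) _; set T := \sum_(k < m) _.
have : T <= m%:R * (ln n.+2%:R + m%:R / n.+2%:R) :> R.
  rewrite mulr_natl -[X in _ *+ X]card_ord -sumr_const; apply: ler_sum => k _.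
  apply: (le_trans (ln_addr_le _ _ n0 _)) => //.
  by rewrite lerD2l ler_pM2r ?invr_gt0// ler_nat ltnW.
rewrite -(ler_pM2l (divr_gt0 x0 m0)).
have -> : x / m%:R * (m%:R * (ln n.+2%:R + m%:R / n.+2%:R)) =
    x * ln n.+2%:R + x * m%:R / n.+2%:R.
  by rewrite mulrA divfK ?gt_eqF// mulrDr mulrA.
rewrite mulrDr mulrBl mul1r.
move: (x / m%:R * T) (x / m%:R * _) (x * ln _) (x * m%:R / _) => p q r s.
by move: (lnGamma _) (lnGamma _) S => *; lra.
Qed.

(** The matching bound comes from the slope over the unit segment to the left of
[n + 2], which is [ln (n + 1)]. *)
Lemma gauss_lnGamma_le n x : 0 < x ->
  gauss_lnGamma n.+2 x <= lnGamma x + x / n.+1%:R.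
Proof.
move=> x0; rewrite /gauss_lnGamma.
have n0 : (0 : R) < n.+1%:R by [].
have x1 : 0 < 1 + x by rewrite addr_gt0.
have := @lnGamma_convex (x / (1 + x)) n.+1%:R (x + n.+2%:R) n0.
rewrite addr_gt0// divr_ge0 ?(ltW x0) ?(ltW x1)//= ler_pdivrMr// mul1r.
rewrite lerDr ler01 => /(_ isT isT).
have -> : x / (1 + x) * n.+1%:R + (1 - x / (1 + x)) * (x + n.+2%:R) = n.+2%:R.
  by rewrite -(natr1 n.+1); field; rewrite gt_eqF.
rewrite lnGammaDn// -(ler_pM2l x1).
set S := \sum_(k < n.+2) _.
have mean u v : (1 + x) * (x / (1 + x) * u + (1 - x / (1 + x)) * v) = x * u + v.
  by field; rewrite gt_eqF.
rewrite mean.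
have hg : lnGamma n.+2%:R = lnGamma n.+1%:R + ln n.+1%:R.
  by rewrite -(natr1 n.+1) lnGammaD1.
have : x * ln n.+2%:R <= x * (ln n.+1%:R + 1 / n.+1%:R).
  by rewrite ler_pM2l// -(natr1 n.+1) ln_addr_le.
rewrite hg !mulrDr mulrDl mulrA mulr1 mul1r.
move: (x * ln _) (x * lnGamma _) (x / _) => p q r.
by move: (lnGamma _) (lnGamma _) S {hg} => *; lra.
Qed.

Lemma gauss_lnGamma_cvg x : 0 < x -> gauss_lnGamma n x @[n --> \oo] --> lnGamma x.
Proof.
move=> x0; rewrite -(cvg_shiftn 2).
pose m := (Num.truncn x).+1.
have xm : x <= m%:R by apply/ltW; exact: truncnS_gt.
apply: (@squeeze_cvgr _ _ _ _ (fun n => lnGamma x - x * m%:R / n.+1%:R)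
                      (fun n => lnGamma x + x / n.+1%:R)).
- apply: nearW => n; rewrite /= addn2 gauss_lnGamma_le// andbT.
  apply: le_trans (gauss_lnGamma_ge _ _ _ x0 xm).
  rewrite lerD2l lerN2 ler_wpM2l// ?mulr_ge0 ?(ltW x0)//.
  by rewrite lef_pV2 ?posrE// ler_nat.
- rewrite -[X in _ --> X]subr0 -[X in _ - X](mulr0 (x * m%:R)).
  by apply: cvgB; [exact: cvg_cst | apply: cvgMr; exact: cvg_harmonic].
- rewrite -[X in _ --> X]addr0 -[X in _ + X](mulr0 x).
  by apply: cvgD; [exact: cvg_cst | apply: cvgMr; exact: cvg_harmonic].
Qed.
End LogGamma.

(** * Sums over shifts: comparison by telescoping, Taylor remainders *)

Section SumsOverShifts.
Context {R : realType}.
Implicit Types (a b T : R -> R) (x y h C K S : R) (n : nat).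

Lemma sum_telescope_shift T x n :
  \sum_(k < n) (T (x + k%:R) - T (x + k%:R + 1)) = T x - T (x + n%:R).
Proof.
elim: n => [|n ih]; first by rewrite big_ord0 addr0 subrr.
by rewrite big_ord_recr/= ih addrA subrK -addrA natr1.
Qed.

Lemma sum_shift_le a T x n :
  (forall y, x <= y -> a y <= T y - T (y + 1)) -> (forall y, x <= y -> 0 <= T y) ->
  \sum_(k < n) a (x + k%:R) <= T x.
Proof.
move=> aT T0; apply: (@le_trans _ _ (T x - T (x + n%:R))).
  rewrite -sum_telescope_shift; apply: ler_sum => k _.
  by apply: aT; rewrite lerDl.
by rewrite gerBl T0// lerDl.
Qed.

Lemma lim_sum_shift_le a T x S :
  (forall y, x <= y -> a y <= T y - T (y + 1)) -> (forall y, x <= y -> 0 <= T y) ->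
  \sum_(k < n) a (x + k%:R) @[n --> \oo] --> S -> S <= T x.
Proof.
move=> aT T0 aS; rewrite -(cvg_lim (@Rhausdorff R) aS); apply: limr_le.
  by apply/cvg_ex; exists S.
by apply: nearW => n; exact: sum_shift_le.
Qed.

(** Strictness survives the limit because it is taken from the first term only. *)
Lemma lim_sum_shift_lt a T x S :
  (forall y, x <= y -> a y < T y - T (y + 1)) -> (forall y, x <= y -> 0 <= T y) ->
  \sum_(k < n) a (x + k%:R) @[n --> \oo] --> S -> S < T x.
Proof.
move=> aT T0; rewrite -cvg_shiftS => aS.
apply: (@le_lt_trans _ _ (a x + T (x + 1))); last first.
  by rewrite -ltrBrDr aT.
rewrite -(cvg_lim (@Rhausdorff R) aS); apply: limr_le.
  by apply/cvg_ex; exists S.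
apply: nearW => n /=; rewrite big_ord_recl/= addr0 lerD2l.
under eq_bigr do rewrite /bump/= add1n -nat1r addrA.
apply: sum_shift_le => y xy.
  by apply/ltW/aT; apply: le_trans xy; rewrite lerDl.
by apply: T0; apply: le_trans xy; rewrite lerDl.
Qed.

Lemma cvg_inv_shift x : 0 < x -> (x + n%:R)^-1 @[n --> \oo] --> (0 : R).
Proof.
move=> x0; rewrite -cvg_shiftS/=.
apply: (@squeeze_cvgr _ _ _ _ (fun=> 0) (fun n => n.+1%:R^-1)).
- apply: nearW => n; rewrite invr_ge0 addr_ge0 ?(ltW x0)//=.
  by rewrite lef_pV2 ?posrE ?addr_gt0// lerDr ltW.
- exact: cvg_cst.
- exact: cvg_harmonic.
Qed.

(** Here the discarded term [T (x + n)] has to vanish in the limit, which the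
bound by [C / y] ensures. *)
Lemma lim_sum_shift_ge a T x C S : 0 < x ->
  (forall y, x <= y -> T y - T (y + 1) <= a y) -> (forall y, x <= y -> T y <= C / y) ->
  \sum_(k < n) a (x + k%:R) @[n --> \oo] --> S -> T x <= S.
Proof.
move=> x0 aT TC aS.
have lo : T x - C * (x + n%:R)^-1 @[n --> \oo] --> T x.
  rewrite -[X in _ --> X]subr0 -[X in _ - X](mulr0 C).
  by apply: cvgB; [exact: cvg_cst | apply: cvgMr; exact: cvg_inv_shift].
rewrite -(cvg_lim (@Rhausdorff R) aS) -(cvg_lim (@Rhausdorff R) lo).
apply: ler_lim; [by apply/cvg_ex; eexists; exact: lo|by apply/cvg_ex; exists S|].
apply: nearW => n; apply: (@le_trans _ _ (T x - T (x + n%:R))).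
  by rewrite lerD2l lerN2 TC// lerDl.
rewrite -sum_telescope_shift; apply: ler_sum => k _.
by apply: aT; rewrite lerDl.
Qed.

Lemma invsqr_lt_telescope y : 0 < y ->
  y ^- 2 < (y^-1 + y ^- 2) - ((y + 1)^-1 + (y + 1) ^- 2).
Proof.
move=> y0; have y1 : 0 < y + 1 by rewrite addr_gt0.
rewrite -subr_gt0.
have -> : y^-1 + y ^- 2 - ((y + 1)^-1 + (y + 1) ^- 2) - y ^- 2 =
   y^-1 * (y + 1) ^- 2 by field; rewrite !gt_eqF.
by rewrite mulr_gt0// ?invr_gt0 ?exprn_gt0.
Qed.

Lemma sum_invsqr_le x n : 0 < x -> \sum_(k < n) (x + k%:R) ^- 2 <= x^-1 + x ^- 2.
Proof.
move=> x0; apply: (sum_shift_le (fun y => y ^- 2) (fun y => y^-1 + y ^- 2)) => y xy.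
  by apply/ltW/invsqr_lt_telescope; exact: lt_le_trans xy.
have y0 : 0 < y by exact: lt_le_trans xy.
by rewrite addr_ge0// invr_ge0 ?exprn_ge0// ltW.
Qed.

(** A remainder of order [h ^+ 2 * y ^- 2] in each term sums to one of order
[h ^+ 2] that does not depend on the number of terms. *)
Lemma sum_shift_taylor a b x K n h : 0 < x -> 0 <= K -> `|h| < x / 2 ->
  (forall y, x <= y -> `|h| < y / 2 ->
     `|a (y + h) - a y - h * b y| <= K * h ^+ 2 * y ^- 2) ->
  `|\sum_(k < n) a (x + h + k%:R) - \sum_(k < n) a (x + k%:R) -
      h * \sum_(k < n) b (x + k%:R)| <= K * (x^-1 + x ^- 2) * h ^+ 2.
Proof.
move=> x0 K0 hx taylor; rewrite mulr_sumr -!sumrB.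
apply: (le_trans (ler_norm_sum _ _ _)).
apply: (@le_trans _ _ (\sum_(k < n) K * h ^+ 2 * (x + k%:R) ^- 2)).
  apply: ler_sum => k _; rewrite (addrAC x h); apply: taylor; first by rewrite lerDl.
  by apply: (lt_le_trans hx); rewrite ler_pM2r ?invr_gt0// lerDl.
rewrite -mulr_sumr [leRHS]mulrAC ler_wpM2l ?sum_invsqr_le//.
  by rewrite mulr_ge0// sqr_ge0.
Qed.

Lemma half_lt_shift y h : 0 < y -> `|h| < y / 2 -> y / 2 < y + h.
Proof. by move=> y0; rewrite ltr_norml => /andP[hy _]; lra. Qed.

Lemma inv_shift_le y h : 0 < y -> `|h| < y / 2 -> 0 < y + h /\ (y + h)^-1 <= 2 / y.
Proof.
move=> y0 /(half_lt_shift _ _ y0) hy.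
have yh0 : 0 < y + h by apply: lt_trans hy; rewrite divr_gt0.
by split => //; rewrite -[leRHS]invf_div lef_pV2 ?posrE ?divr_gt0// ltW.
Qed.

(** Both sides come from [ln (1 + s) <= s], applied to the ratio [(y + h) / y]
and to its inverse. *)
Lemma ln_taylor y h : 0 < y -> `|h| < y / 2 ->
  `|ln (y + h) - ln y - h * y^-1| <= 2 * h ^+ 2 * y ^- 2.
Proof.
move=> y0 hy.
have [yh0 yh2] := inv_shift_le _ _ y0 hy.
have up : ln (y + h) - ln y <= h / y.
  rewrite -ln_div ?posrE//.
  have -> : (y + h) / y = 1 + h / y by field; rewrite gt_eqF.
  by apply: le_ln1Dx; rewrite -subr_gt0 opprK addrC (_ : 1 + h / y = (y + h) / y) ?divr_gt0//; field; rewrite gt_eqF.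
have lo : ln y - ln (y + h) <= - h / (y + h).
  rewrite -ln_div ?posrE//.
  have e : y / (y + h) = 1 + - h / (y + h) by field; rewrite gt_eqF.
  by rewrite e; apply: le_ln1Dx; rewrite -subr_gt0 opprK addrC -e divr_gt0.
rewrite ler_norml; apply/andP; split; last first.
  apply: (@le_trans _ _ 0); first by rewrite subr_le0.
  by rewrite mulr_ge0 ?invr_ge0 ?sqr_ge0// mulr_ge0 ?sqr_ge0.
have : h ^+ 2 * y^-1 * (y + h)^-1 <= h ^+ 2 * y^-1 * (2 / y).
  by rewrite ler_wpM2l// mulr_ge0 ?sqr_ge0// invr_ge0 ltW.
have -> : h ^+ 2 * y^-1 * (y + h)^-1 = h / y + - h / (y + h).
  by field; rewrite !gt_eqF.
have -> : h ^+ 2 * y^-1 * (2 / y) = 2 * h ^+ 2 * y ^- 2 by field; rewrite gt_eqF.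
by lra.
Qed.

Lemma inv_taylor x y h : x <= y -> 0 < x -> `|h| < y / 2 ->
  `|(y + h)^-1 - y^-1 - h * (- y ^- 2)| <= (2 / x) * h ^+ 2 * y ^- 2.
Proof.
move=> xy x0 hy; have y0 : 0 < y by exact: lt_le_trans xy.
have [yh0 yh2] := inv_shift_le _ _ y0 hy.
have -> : (y + h)^-1 - y^-1 - h * (- y ^- 2) = (y + h)^-1 * (h ^+ 2 * y ^- 2).
  by field; rewrite !gt_eqF.
have p0 : 0 <= h ^+ 2 * y ^- 2 by rewrite mulr_ge0 ?sqr_ge0// invr_ge0 sqr_ge0.
rewrite ger0_norm; last by rewrite mulr_ge0// invr_ge0 ltW.
rewrite -mulrA ler_wpM2r//; apply: (le_trans yh2).
by rewrite ler_pM2l// lef_pV2.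
Qed.

Lemma invsqr_taylor x y h : x <= y -> 0 < x -> `|h| < y / 2 ->
  `|(y + h) ^- 2 - y ^- 2 - h * (- 2 * y ^- 3)| <= (16 / x ^+ 2) * h ^+ 2 * y ^- 2.
Proof.
move=> xy x0 hy; have y0 : 0 < y by exact: lt_le_trans xy.
have [yh0 yh2] := inv_shift_le _ _ y0 hy.
have -> : (y + h) ^- 2 - y ^- 2 - h * (- 2 * y ^- 3) =
    ((3 * y + 2 * h) / y) * ((y + h)^-1 ^+ 2) * (h ^+ 2 * y ^- 2).
  by field; rewrite !gt_eqF.
have p0 : 0 <= h ^+ 2 * y ^- 2 by rewrite mulr_ge0 ?sqr_ge0// invr_ge0 sqr_ge0.
have q0 : 0 <= (3 * y + 2 * h) / y.
  by rewrite divr_ge0 ?(ltW y0)//; move: hy; rewrite ltr_norml => /andP[]; lra.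
have q4 : (3 * y + 2 * h) / y <= 4.
  by rewrite ler_pdivrMr//; move: hy; rewrite ltr_norml => /andP[]; lra.
have r0 : 0 <= (y + h)^-1 by rewrite invr_ge0 ltW.
rewrite ger0_norm; last by rewrite mulr_ge0// mulr_ge0// exprn_ge0.
rewrite -[leRHS]mulrA ler_wpM2r//.
have -> : 16 / x ^+ 2 = 4 * (2 / x) ^+ 2 by field; rewrite gt_eqF.
apply: ler_pM; rewrite ?exprn_ge0//.
rewrite lerXn2r// ?nnegrE ?divr_ge0 ?(ltW x0)//; apply: (le_trans yh2).
by rewrite ler_pM2l// lef_pV2.
Qed.
End SumsOverShifts.

(** * Series for the derivatives of the digamma function *)

Section Polygamma.
Context {R : realType}.
Implicit Types (x y h : R) (n : nat).

Lemma shift_gt0 x y : `|y - x| < x / 2 -> 0 < y.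
Proof. by rewrite ltr_norml => /andP[]; lra. Qed.

(** The limit is stated as a derivative of [lnGamma], so that [psiE] can identify
it with the quotient defining [psi]. *)
Lemma lnGamma_derive1_cvg x : 0 < x ->
  ln n%:R - \sum_(k < n) (x + k%:R)^-1 @[n --> \oo] --> (@lnGamma R)^`()%classic x /\
  derivable (@lnGamma R) x 1.
Proof.
move=> x0.
have [] := @is_derive_lim R gauss_lnGamma lnGamma
    (fun n => ln n%:R - \sum_(k < n) (x + k%:R)^-1) x (x / 2)
    (2 * (x^-1 + x ^- 2)).
- by rewrite divr_gt0.
- by move=> y /shift_gt0; exact: gauss_lnGamma_cvg.
- move=> n h hx.
  have := sum_shift_taylor (@ln R) (fun y => y^-1) x 2 n h x0 _ hx.
  move=> /(_ (ler0n _ 2) (fun y xy => ln_taylor y h (lt_le_trans x0 xy))).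
  rewrite -normrN; congr (`|_| <= _).
  rewrite /gauss_lnGamma; move: (\sum_(k < n) _) (\sum_(k < n) _) (\sum_(k < n) _) => p q r.
  by move: (lnGamma _) (ln _) => *; ring.
by move=> l [dl [dx dE]]; rewrite derive1E dE.
Qed.

Lemma is_derive_lnGamma x : 0 < x -> is_derive x 1 lnGamma ((@lnGamma R)^`()%classic x).
Proof.
by move=> x0; rewrite derive1E; apply: DeriveDef => //; have [] := lnGamma_derive1_cvg _ x0.
Qed.

Lemma psiE x : 0 < x -> psi x = (@lnGamma R)^`()%classic x.
Proof.
move=> x0; have lgx := is_derive_lnGamma _ x0.
have : is_derive x 1 (@Gamma R) (expR (lnGamma x) * (@lnGamma R)^`()%classic x).
  apply: (@near_eq_is_derive _ _ _ (expR \o lnGamma)).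
    by near=> y; rewrite /= expR_lnGamma//; near: y; exact: lt_nbhsr.
move=> [_ dG]; rewrite /psi derive1E dG expR_lnGamma// mulrAC divff ?mul1r//.
by rewrite gt_eqF// Gamma_gt0.
Unshelve. all: by end_near. Qed.

Lemma psi_cvg x : 0 < x ->
  ln n%:R - \sum_(k < n) (x + k%:R)^-1 @[n --> \oo] --> psi x.
Proof.
move=> x0.
rewrite (psiE _ x0).
exact: (lnGamma_derive1_cvg _ x0).1.
Qed.

Lemma trigamma_cvg x : 0 < x ->
  \sum_(k < n) (x + k%:R) ^- 2 @[n --> \oo] --> (@psi R)^`()%classic x.
Proof.
move=> x0.
have [] := @is_derive_lim R (fun n y => ln n%:R - \sum_(k < n) (y + k%:R)^-1) psi
    (fun n => \sum_(k < n) (x + k%:R) ^- 2) x (x / 2)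
    ((2 / x) * (x^-1 + x ^- 2)).
- by rewrite divr_gt0.
- by move=> y /shift_gt0; exact: psi_cvg.
- move=> n h hx.
  have := sum_shift_taylor (fun y => y^-1) (fun y => - y ^- 2) x (2 / x) n h x0 _ hx.
  rewrite divr_ge0 ?(ltW x0)// => /(_ isT (fun y xy => inv_taylor x y h xy x0)).
  rewrite -normrN; congr (`|_| <= _).
  rewrite sumrN; move: (\sum_(k < n) _) (\sum_(k < n) _) (\sum_(k < n) _) => p q r.
  by move: (ln _) => *; ring.
by move=> l [dl [_ dE]]; rewrite derive1E dE.
Qed.

Lemma tetragamma_cvg x : 0 < x ->
  \sum_(k < n) (- 2 * (x + k%:R) ^- 3) @[n --> \oo] --> (@psi R)^`(2)%classic x.
Proof.
move=> x0.
have [] := @is_derive_lim R (fun n y => \sum_(k < n) (y + k%:R) ^- 2) (@psi R)^`()%classic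
    (fun n => \sum_(k < n) (- 2 * (x + k%:R) ^- 3)) x (x / 2)
    ((16 / x ^+ 2) * (x^-1 + x ^- 2)).
- by rewrite divr_gt0.
- by move=> y /shift_gt0; exact: trigamma_cvg.
- move=> n h hx.
  apply: (sum_shift_taylor (fun y => y ^- 2) (fun y => - 2 * y ^- 3)) => //.
    by rewrite divr_ge0 ?sqr_ge0.
  by move=> y xy; exact: invsqr_taylor.
by move=> l [dl [_ dE]]; rewrite derive1nS derive1n1 derive1E dE.
Qed.
End Polygamma.

(** * Elementary bounds on the trigamma and tetragamma functions *)

Section PolygammaBounds.
Context {R : realType}.
Implicit Types (x y : R).

(** With [u = x^-1] the left-hand side is [u * (u + 6 / (6 + 3 u + u ^+ 2))], the
shape of the upper bound in [todd_lt].  The first term of the series is kept;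
the fraction agrees with [psi' (x + 1)] to second order at infinity. *)
Lemma trigamma_ge x : 0 < x ->
  x ^- 2 + 6 * x / (6 * x ^+ 2 + 3 * x + 1) <= (@psi R)^`()%classic x.
Proof.
move=> x0.
apply: (lim_sum_shift_ge (fun y => y ^- 2)
  (fun y => y ^- 2 + 6 * y / (6 * y ^+ 2 + 3 * y + 1)) x (x^-1 + 1)) (trigamma_cvg _ x0) => //.
- move=> y xy.
  have y0 : 0 < y by exact: lt_le_trans xy.
  have y1 : 0 < y + 1 by rewrite addr_gt0.
  have d0 : 0 < 6 * y ^+ 2 + 3 * y + 1 by nra.
  have d1 : 0 < 6 * (y + 1) ^+ 2 + 3 * (y + 1) + 1 by nra.
  have q0 : 0 <= 9 * y ^+ 2 + 21 * y + 16 by nra.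
  rewrite -subr_ge0.
  have -> : y ^- 2 - (y ^- 2 + 6 * y / (6 * y ^+ 2 + 3 * y + 1) -
      ((y + 1) ^- 2 + 6 * (y + 1) / (6 * (y + 1) ^+ 2 + 3 * (y + 1) + 1))) =
    (9 * y ^+ 2 + 21 * y + 16) / ((y + 1) ^+ 2 * (6 * y ^+ 2 + 3 * y + 1) *
      (6 * (y + 1) ^+ 2 + 3 * (y + 1) + 1)).
    by field; rewrite !gt_eqF.
  by rewrite divr_ge0// mulr_ge0 ?(ltW d1)// mulr_ge0 ?(ltW d0)// sqr_ge0.
- move=> y xy.
  have y0 : 0 < y by exact: lt_le_trans xy.
  have d0 : 0 < 6 * y ^+ 2 + 3 * y + 1 by nra.
  rewrite /= [leRHS]mulrDl mul1r; apply: lerD.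
    by rewrite expr2 invfM ler_wpM2r ?invr_ge0 ?(ltW y0)// lef_pV2.
  by rewrite ler_pdivrMr// ler_pdivlMl//; nra.
Qed.

Lemma trigamma_lt x : 0 < x -> (@psi R)^`()%classic x < x^-1 + x ^- 2.
Proof.
move=> x0.
apply: (lim_sum_shift_lt (fun y => y ^- 2) (fun y => y^-1 + y ^- 2) x)
  (trigamma_cvg _ x0) => y xy.
  by apply: invsqr_lt_telescope; exact: lt_le_trans xy.
have y0 : 0 < y by exact: lt_le_trans xy.
by rewrite addr_ge0// invr_ge0 ?exprn_ge0// ltW.
Qed.

Lemma tetragammaN_cvg x : 0 < x ->
  \sum_(k < n) 2 * (x + k%:R) ^- 3 @[n --> \oo] --> - (@psi R)^`(2)%classic x.
Proof.
move=> x0.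
rewrite (_ : (fun n => _) = (fun n => - \sum_(k < n) (- 2 * (x + k%:R) ^- 3))).
  exact: cvgN (tetragamma_cvg _ x0).
apply/funext => n.
by rewrite -sumrN; apply: eq_bigr => k _; rewrite mulNr opprK.
Qed.

Lemma tetragamma_ge x : 0 < x -> - (x ^- 2 + 2 * x ^- 3) <= (@psi R)^`(2)%classic x.
Proof.
move=> x0; rewrite lerNl.
apply: (lim_sum_shift_le (fun y => 2 * y ^- 3) (fun y => y ^- 2 + 2 * y ^- 3) x)
  (tetragammaN_cvg _ x0) => y xy.
  have y0 : 0 < y by exact: lt_le_trans xy.
  have y1 : 0 < y + 1 by rewrite addr_gt0.
  rewrite -subr_ge0.
  have -> : y ^- 2 + 2 * y ^- 3 - ((y + 1) ^- 2 + 2 * (y + 1) ^- 3) - 2 * y ^- 3 =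
     (3 * y + 1) * (y ^- 2 * (y + 1) ^- 3) by field; rewrite !gt_eqF.
  have y31 : 0 <= 3 * y + 1 by lra.
  by rewrite mulr_ge0// mulr_ge0// invr_ge0 exprn_ge0 ?ltW.
have y0 : 0 < y by exact: lt_le_trans xy.
by rewrite addr_ge0 ?mulr_ge0// invr_ge0 exprn_ge0 ?ltW.
Qed.

(** Near [0] the first term of the series dominates.  Taking it as a telescoping
[T] reuses the comparison lemma. *)
Lemma tetragamma_le_cube x : 0 < x -> (@psi R)^`(2)%classic x <= - (2 * x ^- 3).
Proof.
move=> x0; rewrite lerNr.
apply: (lim_sum_shift_ge (fun y => 2 * y ^- 3) (fun y => 2 * y ^- 3) x (2 * x ^- 2))
  (tetragammaN_cvg _ x0) => // y xy.
  by rewrite gerBl mulr_ge0// invr_ge0 exprn_ge0// addr_ge0// ltW// (lt_le_trans x0).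
have y0 : 0 < y by exact: lt_le_trans xy.
rewrite -mulrA ler_pM2l// (exprSr y) invfM ler_wpM2r ?invr_ge0 ?(ltW y0)//.
by rewrite lef_pV2 ?posrE ?exprn_gt0// lerXn2r// nnegrE ltW.
Qed.

(** With [T y = (y^-1 + y ^- 2 / 2) ^+ 2], the difference
[2 y^-3 - (T y - T (y + 1))] is, over [4 y^4 (y + 1)^4], the difference of squares
[((2y + 3) y^2)^2 - ((2y - 1) (y + 1)^2)^2].  One factor is the constant 1, the
other is positive for [y >= 1/2].  The range cannot be extended to all [y > 0],
since [T y] is of order [y^-4] at [0] and [- psi''] only of order [y^-3]. *)
Lemma tetragamma_le_sqr x : 1 / 2 <= x ->
  (@psi R)^`(2)%classic x <= - (x^-1 + x ^- 2 / 2) ^+ 2.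
Proof.
move=> x2; have x0 : 0 < x by lra.
rewrite lerNr.
apply: (lim_sum_shift_ge (fun y => 2 * y ^- 3) (fun y => (y^-1 + y ^- 2 / 2) ^+ 2) x 8)
  (tetragammaN_cvg _ x0) => // y xy.
  have y0 : 0 < y by exact: lt_le_trans xy.
  have y1 : 0 < y + 1 by rewrite addr_gt0.
  have q0 : 0 <= 4 * y ^+ 3 + 6 * y ^+ 2 - 1 by nra.
  rewrite -subr_ge0.
  have -> : 2 * y ^- 3 - ((y^-1 + y ^- 2 / 2) ^+ 2 -
      ((y + 1)^-1 + (y + 1) ^- 2 / 2) ^+ 2) =
    (4 * y ^+ 3 + 6 * y ^+ 2 - 1) / (4 * y ^+ 4 * (y + 1) ^+ 4).
    by field; rewrite !gt_eqF.
  have y4 : 0 <= y ^+ 4 by rewrite exprn_ge0// ltW.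
  have y14 : 0 <= (y + 1) ^+ 4 by rewrite exprn_ge0// ltW.
  by rewrite divr_ge0// mulr_ge0// mulr_ge0.
have y0 : 0 < y by exact: lt_le_trans xy.
have -> : (y^-1 + y ^- 2 / 2) ^+ 2 = y^-1 * (y^-1 * (1 + y^-1 / 2) ^+ 2).
  by field; rewrite gt_eqF.
rewrite mulrC ler_pM2r ?invr_gt0//.
have z0 : 0 < y^-1 by rewrite invr_gt0.
have z2 : y^-1 <= 2 by rewrite -[leRHS]invrK lef_pV2 ?posrE//; lra.
nra.
Qed.
End PolygammaBounds.

(** * Bounds on the Todd function *)

Section ExponentialBounds.
Context {R : realType}.
Implicit Types (v x y : R).

(** The Todd function [v / (1 - expR (- v))]. *)
Definition todd v : R := v * expR v / (expR v - 1).

(** The derivative of [v |-> v * todd v]. *)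
Definition deriv_v_todd v : R := v * expR v * (2 * (expR v - 1) - v) / (expR v - 1) ^+ 2.

Lemma expRB1_gt0 v : 0 < v -> 0 < expR v - 1.
Proof. by move=> v0; rewrite subr_gt0 pexpR_gt1. Qed.

Lemma expR_gt_cubic v : 0 < v -> 1 + v + v ^+ 2 / 2 + v ^+ 3 / 6 < expR v.
Proof.
move=> v0; apply: (@lt_le_trans _ _ (series (exp_coeff v) 5)).
  rewrite /series /exp_coeff /= !big_nat_recr//= big_geq// add0r.
  rewrite !factS fact0 !muln1 expr0 expr1 !divr1.
  have : 0 < v ^+ 4 / 24%:R by rewrite divr_gt0 ?exprn_gt0.
  by move=> v4; rewrite ltrDl.
apply: nondecreasing_cvgn_le; last exact: is_cvg_series_exp_coeff.
by apply: nondecreasing_series => n _ _; exact: exp_coeff_ge0 (ltW v0).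
Qed.

Lemma todd_lt v : 0 < v -> todd v < v + 6 / (6 + 3 * v + v ^+ 2).
Proof.
move=> v0; have w0 := expRB1_gt0 _ v0.
have d0 : 0 < 6 + 3 * v + v ^+ 2 by nra.
have -> : todd v = v + v / (expR v - 1) by rewrite /todd; field; rewrite gt_eqF.
rewrite ltrD2l ltr_pdivrMr// mulrAC ltr_pdivlMr//.
by have := expR_gt_cubic _ v0; move: (expR v) => E; nra.
Qed.

Lemma ge0_of_derive (f g : R -> R) v : (forall y, is_derive y 1 f (g y)) ->
  (forall y, 0 < y -> 0 <= g y) -> f 0 = 0 -> 0 <= v -> 0 <= f v.
Proof.
move=> fg g0 f0 v0; rewrite -f0.
apply: (@ger0_derive1_ndecry _ f 0) => //.
- by move=> y; rewrite in_itv/= andbT => y0; rewrite derive1E derive_val g0.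
- apply: derivable_within_continuous => y _; exact: ex_derive.
Qed.

(** Cleared of denominators, the difference [(v - 2) expR v + v + 2] vanishes at
[0], and its derivative is nonnegative because [1 - v <= expR (- v)]. *)
Lemma todd_ge v : 0 < v -> 1 + v / 2 <= todd v.
Proof.
move=> v0; have w0 := expRB1_gt0 _ v0.
have : 0 <= (v - 2) * expR v + v + 2.
  apply: (@ge0_of_derive (fun v => (v - 2) * expR v + v + 2)
            (fun v => (v - 1) * expR v + 1)) (ltW v0).
  - by move=> y; apply: trigger_derive; rewrite /GRing.scale/=; ring.
  - move=> y y0; have := expR_ge1Dx (- y); rewrite expRN -(ler_pM2r (expR_gt0 y)).
    by rewrite mulVf ?gt_eqF ?expR_gt0//; move: (expR y) => E; nra.
  - by rewrite expR0; ring.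
rewrite /todd ler_pdivlMr//; move: (expR v) => E; nra.
Qed.

(** The difference is a perfect square. *)
Lemma deriv_v_todd_le_sqr v : 0 < v -> deriv_v_todd v <= (1 + v / 2) ^+ 2.
Proof.
move=> v0; have w0 := expRB1_gt0 _ v0; rewrite -subr_ge0.
have -> : (1 + v / 2) ^+ 2 - deriv_v_todd v = ((1 - v / 2) - v / (expR v - 1)) ^+ 2.
  by rewrite /deriv_v_todd; field; rewrite gt_eqF.
exact: sqr_ge0.
Qed.

Lemma deriv_v_todd_le_double v : 2 <= v -> deriv_v_todd v <= 2 * v.
Proof.
move=> v2; have v0 : 0 < v by lra.
have w0 := expRB1_gt0 _ v0; rewrite -subr_ge0.
have -> : 2 * v - deriv_v_todd v = v * ((v - 2) * expR v + 2) / (expR v - 1) ^+ 2.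
  by rewrite /deriv_v_todd; field; rewrite gt_eqF.
have E0 := expR_gt0 v.
by rewrite divr_ge0 ?sqr_ge0// mulr_ge0 ?(ltW v0)//; nra.
Qed.

(** Up to a positive factor the difference is
[(v - 1) expR v - (v + 1) expR (- v) + 2 - v ^+ 2], which vanishes at [0] and
has derivative [v (expR v + expR (- v) - 2)], a nonnegative multiple of a
square. *)
Lemma deriv_v_todd_ge v : 0 < v -> 1 + v <= deriv_v_todd v.
Proof.
move=> v0; have w0 := expRB1_gt0 _ v0; rewrite -subr_ge0.
have -> : deriv_v_todd v - (1 + v) =
    ((v - 1) * expR v - (v + 1) * expR (- v) + 2 - v ^+ 2) *
    (expR v / (expR v - 1) ^+ 2).
  rewrite /deriv_v_todd expRN; field.
  by rewrite !gt_eqF ?expR_gt0.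
apply: mulr_ge0; last by rewrite divr_ge0 ?sqr_ge0// expR_ge0.
apply: (@ge0_of_derive (fun v => (v - 1) * expR v - (v + 1) * expR (- v) + 2 - v ^+ 2)
          (fun v => v * expR (- v) * (expR v - 1) ^+ 2)) (ltW v0).
- move=> y; apply: trigger_derive; rewrite /GRing.scale/=.
  rewrite expRN; field; rewrite gt_eqF ?expR_gt0//.
- by move=> y y0; rewrite mulr_ge0 ?sqr_ge0// mulr_ge0 ?expR_ge0 ?(ltW y0).
- by rewrite oppr0 expR0; ring.
Qed.
End ExponentialBounds.

(** * Comparison after rescaling *)

Section Rescaling.
Context {R : realType}.
Implicit Types (theta x : R).

Lemma trigamma_boundE theta x : 0 < theta -> 0 < x ->
  theta * expR (theta / x) / (x ^+ 2 * (expR (theta / x) - 1)) =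
  x^-1 * todd (theta / x).
Proof.
move=> t0 x0; have w0 := expRB1_gt0 _ (divr_gt0 t0 x0).
by rewrite /todd; move: (expR _) w0 => E w0; field; rewrite !gt_eqF.
Qed.

Lemma tetragamma_boundE theta x : 0 < theta -> 0 < x ->
  theta * expR (theta / x) * (theta - 2 * x * (expR (theta / x) - 1)) /
    (x ^+ 4 * (expR (theta / x) - 1) ^+ 2) =
  - (x ^- 2 * deriv_v_todd (theta / x)).
Proof.
move=> t0 x0; have w0 := expRB1_gt0 _ (divr_gt0 t0 x0).
by rewrite /deriv_v_todd; move: (expR _) w0 => E w0; field; rewrite !gt_eqF.
Qed.

(** The upper bound of [todd_lt] is increasing in [v], so that [theta = 1] is the
extreme case, in which it is exactly the lower bound of [trigamma_ge]. *)
Lemma trigamma_gt_todd theta x : 0 < theta -> theta <= 1 -> 0 < x ->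
  x^-1 * todd (theta / x) < (@psi R)^`()%classic x.
Proof.
move=> t0 t1 x0; apply: (lt_le_trans _ (trigamma_ge _ x0)).
have d0 : 0 < 6 * x ^+ 2 + 3 * x + 1 by nra.
have -> : x ^- 2 + 6 * x / (6 * x ^+ 2 + 3 * x + 1) =
    x^-1 * (x^-1 + 6 / (6 + 3 * x^-1 + x^-1 ^+ 2)).
  by field; rewrite !gt_eqF//=; nra.
rewrite ltr_pM2l ?invr_gt0//.
apply: (lt_le_trans (todd_lt _ (divr_gt0 t0 x0))).
set v := theta / x; set u := x^-1.
have v0 : 0 < v by rewrite divr_gt0.
have vu : v <= u by rewrite /v /u ler_pdivrMr// mulVf ?gt_eqF.
have dv : 0 < 6 + 3 * v + v ^+ 2 by nra.
have du : 0 < 6 + 3 * u + u ^+ 2 by nra.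
rewrite -subr_ge0.
have -> : u + 6 / (6 + 3 * u + u ^+ 2) - (v + 6 / (6 + 3 * v + v ^+ 2)) =
  (u - v) * (18 + 12 * (u + v) + 6 * (u ^+ 2 + v ^+ 2) + 9 * u * v +
   3 * u * v * (u + v) + u ^+ 2 * v ^+ 2) / ((6 + 3 * u + u ^+ 2) * (6 + 3 * v + v ^+ 2)).
  field; rewrite !gt_eqF//.
rewrite divr_ge0 ?mulr_ge0 ?(ltW du) ?(ltW dv) ?subr_ge0//.
have u0 : 0 < u by exact: lt_le_trans vu.
have uv0 : 0 <= u * v by rewrite mulr_ge0 ?ltW.
nra.
Qed.

(** For [x >= 1/2] the bounds by squares match.  For [x <= 1/2] the bound [2u^3] takes over, where [u = 1/x >= 2]: then
[deriv_v_todd v <= (1 + v/2)^2 <= 4 <= 2u] if [v <= 2], and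
[deriv_v_todd v <= 2v <= 2u] if [v >= 2]. *)
Lemma tetragamma_le_todd theta x : 0 < theta -> theta <= 1 -> 0 < x ->
  (@psi R)^`(2)%classic x <= - (x ^- 2 * deriv_v_todd (theta / x)).
Proof.
move=> t0 t1 x0; set v := theta / x; pose u := x^-1.
have u0 : 0 < u by rewrite invr_gt0.
have v0 : 0 < v by rewrite divr_gt0.
have vu : v <= u by rewrite /v /u ler_pdivrMr// mulVf ?gt_eqF.
have sqr_v := deriv_v_todd_le_sqr _ v0.
have x20 : 0 < x ^- 2 by rewrite invr_gt0 exprn_gt0.
have [x2|/ltW x2] := leP (1 / 2) x.
  apply: (le_trans (tetragamma_le_sqr _ x2)); rewrite lerN2.
  have -> : (x^-1 + x ^- 2 / 2) ^+ 2 = x ^- 2 * (1 + u / 2) ^+ 2.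
    by rewrite /u; field; rewrite gt_eqF.
  by rewrite ler_pM2l//; apply: (le_trans sqr_v); nra.
apply: (le_trans (tetragamma_le_cube _ x0)); rewrite lerN2.
have -> : 2 * x ^- 3 = x ^- 2 * (2 * u) by rewrite /u; field; rewrite gt_eqF.
rewrite ler_pM2l//.
have u2 : 2 <= u by rewrite -[leLHS]invrK lef_pV2 ?posrE//; lra.
have [v2|/ltW v2] := leP 2 v.
  by apply: (le_trans (deriv_v_todd_le_double _ v2)); lra.
by apply: (le_trans sqr_v); nra.
Qed.

Lemma trigamma_lt_todd theta x : 2 <= theta -> 0 < x ->
  (@psi R)^`()%classic x < x^-1 * todd (theta / x).
Proof.
move=> t2 x0; have t0 : 0 < theta by lra.
apply: (lt_le_trans (trigamma_lt _ x0)).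
have -> : x^-1 + x ^- 2 = x^-1 * (1 + x^-1) by field; rewrite gt_eqF.
rewrite ler_pM2l ?invr_gt0//.
apply: le_trans (todd_ge _ (divr_gt0 t0 x0)).
by rewrite lerD2l mulrAC ler_peMl ?invr_ge0 ?(ltW x0)//; lra.
Qed.

Lemma tetragamma_ge_todd theta x : 2 <= theta -> 0 < x ->
  - (x ^- 2 * deriv_v_todd (theta / x)) <= (@psi R)^`(2)%classic x.
Proof.
move=> t2 x0; have t0 : 0 < theta by lra.
apply: le_trans (tetragamma_ge _ x0); rewrite lerN2.
have -> : x ^- 2 + 2 * x ^- 3 = x ^- 2 * (1 + 2 / x) by field; rewrite gt_eqF.
rewrite ler_pM2l ?invr_gt0 ?exprn_gt0//.
apply: le_trans (deriv_v_todd_ge _ (divr_gt0 t0 x0)).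
by rewrite lerD2l ler_pM2r ?invr_gt0.
Qed.
End Rescaling.

Theorem corollary2 (R : realType) (theta : R) :
  (0 < theta /\ theta <= 1 ->
   forall x : R, 0 < x ->
     ((@psi R)^`())%classic x >
       theta * expR (theta / x) / (x ^+ 2 * (expR (theta / x) - 1)) /\
     ((@psi R)^`(2))%classic x <=
       theta * expR (theta / x) * (theta - 2 * x * (expR (theta / x) - 1)) /
         (x ^+ 4 * (expR (theta / x) - 1) ^+ 2)) /\
  (2 <= theta ->
   forall x : R, 0 < x ->
     ((@psi R)^`())%classic x <
       theta * expR (theta / x) / (x ^+ 2 * (expR (theta / x) - 1)) /\
     ((@psi R)^`(2))%classic x >=
       theta * expR (theta / x) * (theta - 2 * x * (expR (theta / x) - 1)) /
         (x ^+ 4 * (expR (theta / x) - 1) ^+ 2)).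
Proof.
split=> [[t0 t1] x x0|t2 x x0].
  rewrite (trigamma_boundE _ _ t0 x0) (tetragamma_boundE _ _ t0 x0).
  by split; [exact: trigamma_gt_todd|exact: tetragamma_le_todd].
have t0 : 0 < theta by lra.
rewrite (trigamma_boundE _ _ t0 x0) (tetragamma_boundE _ _ t0 x0).
by split; [exact: trigamma_lt_todd|exact: tetragamma_ge_todd].
Qed.
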